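(* Let $Y$ be a closed parallelepiped of $\mathbb{R}^d$, $d\ge2$. Let $U\in C^1(\mathbb{R}^d)^d$ be such that $DU$ is $Y$-periodic, $\det\big(\langle DU\rangle\big)\neq0$, and $$\det\big(\langle DU\rangle\,DU\big)>0\quad\text{everywhere in }\mathbb{R}^d .$$ Consider a convex function $\varphi\in C^2(\mathbb{R}^d)$ whose Hessian matrix $\nabla^2\varphi$ is positive definite everywhere in $\mathbb{R}^d$. Then $DU$ is a realizable electric matrix field in $\mathbb{R}^d$ with the conductivity $$\sigma:=J\,(DU)^{-1},\quad\text{where}\quad J:=\det\big(\langle DU\rangle\big)\,\mathrm{Cof}\big(D(\nabla\varphi\circ U)\big).$$
   Context: $\langle\cdot\rangle$ denotes the average over $Y$. For $U=(U_1,\dots,U_d)$, $DU:=\left[\partial U_j/\partial x_i\right]_{1\le i,j\le d}$ (the $j$-th column is $\nabla U_j$). For a matrix field $\Sigma=[\Sigma_{ij}]$, $\operatorname{Div}(\Sigma):=\left(\sum_{i=1}^d\partial\Sigma_{ij}/\partial x_i\right)_{1\le j\le d}$. $\mathrm{Cof}(A)$ denotes the cofactor matrix of $A$, with $\mathrm{Cof}(A)=\det(A)\,(A^{-1})^T$ for invertible $A$. $DU$ is a realizable electric matrix field in $\mathbb{R}^d$ with the conductivity $\sigma$ if $\sigma\in L^\infty_{\rm loc}(\mathbb{R}^d)^{d\times d}$ is symmetric positive definite matrix-valued and $\operatorname{Div}(\sigma DU)=0$ in the sense of distributions on $\mathbb{R}^d$. *)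

(* Defs.v *)
From HB Require Import structures.
From mathcomp Require Import all_boot all_order all_algebra.
From mathcomp Require Import all_classical all_reals all_analysis.
From mathcomp Require Import measurable_realfun.

Set Implicit Arguments.
Unset Strict Implicit.
Unset Printing Implicit Defensive.

Import Order.TTheory GRing.Theory Num.Theory.
Import numFieldNormedType.Exports.

Local Open Scope classical_set_scope.
Local Open Scope ring_scope.

(* Row vectors carry the sigma-algebra generated by the coordinates, as tuples do
   in the library; over the reals it is the Borel sigma-algebra. *)
Definition measure_rV_display : measure_display -> measure_display.
Proof. exact. Qed.

Section measurable_rV.
Context {d} {T : sigmaRingType d}.
Variable n : nat.

Let coors (i : 'I_n) (x : 'rV[T]_n) : T := x ord0 i.

Let rV_set0 : g_sigma_preimage coors set0.
Proof. exact: sigma_algebra0. Qed.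

Let rV_setC A : g_sigma_preimage coors A -> g_sigma_preimage coors (~` A).
Proof. exact: sigma_algebraC. Qed.

Let rV_bigcup (F : _^nat) : (forall i, g_sigma_preimage coors (F i)) ->
  g_sigma_preimage coors (\bigcup_i (F i)).
Proof. exact: sigma_algebra_bigcup. Qed.

HB.instance Definition _ := @isMeasurable.Build (measure_rV_display d)
  'rV[T]_n (g_sigma_preimage coors) rV_set0 rV_setC rV_bigcup.

End measurable_rV.

Lemma measurable_coord_rV d (T : sigmaRingType d) n (i : 'I_n) :
  measurable_fun [set: 'rV[T]_n] (fun x => x ord0 i).
Proof.
move=> _ Y mY; rewrite setTI; apply: sub_sigma_algebra => /=.
rewrite -bigcup_seq/=; exists i => /=; first by rewrite mem_index_enum.
by exists Y => //; rewrite setTI.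
Qed.

Lemma measurable_fun_rVP d d1 (S : measurableType d1) (T : measurableType d) n
    (f : S -> 'rV[T]_n) :
  (forall i, measurable_fun [set: S] (fun x => f x ord0 i)) ->
  measurable_fun [set: S] f.
Proof.
move=> mf _ A; rewrite setTI; set G := (X in X A -> _) => GA.
suff : G `<=` [set A | measurable (f @^-1` A)] by exact.
apply: smallest_sub.
  split=> [|B|F] /=; first by rewrite preimage_set0.
  - by move=> mB; rewrite setTD -preimage_setC; exact: measurableC.
  - by move=> mF; rewrite preimage_bigcup; exact: bigcup_measurable.
move=> B; rewrite -bigcup_seq => -[i _ [C mC <-]] /=.
by rewrite setTI; have := mf i measurableT C mC; rewrite setTI.
Qed.

Section lebesgue_rV.
Context {R : realType}.

Definition rV_cons n (p : R * 'rV[R]_n) : 'rV[R]_n.+1 :=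
  \row_i (if unlift ord0 i is Some j then p.2 ord0 j else p.1).

Definition rV_uncons n (x : 'rV[R]_n.+1) : R * 'rV[R]_n :=
  (x ord0 ord0, \row_(i < n) x ord0 (lift ord0 i)).

Lemma rV_cons0 n (p : R * 'rV[R]_n) : rV_cons p ord0 ord0 = p.1.
Proof. by rewrite mxE unlift_none. Qed.

Lemma rV_cons_lift n (p : R * 'rV[R]_n) (i : 'I_n) :
  rV_cons p ord0 (lift ord0 i) = p.2 ord0 i.
Proof. by rewrite mxE liftK. Qed.

Lemma rV_consK n : cancel (@rV_cons n) (@rV_uncons n).
Proof.
move=> [a x]; rewrite /rV_uncons rV_cons0; congr (_, _).
by apply/rowP => i; rewrite mxE rV_cons_lift.
Qed.

Lemma rV_unconsK n : cancel (@rV_uncons n) (@rV_cons n).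
Proof.
move=> x; apply/rowP => i; have [->|] := eqVneq i ord0; first by rewrite rV_cons0.
by rewrite eq_sym => /unlift_some[j -> _]; rewrite rV_cons_lift mxE.
Qed.

Lemma measurable_rV_cons n :
  measurable_fun [set: measurableTypeR R * 'rV[R]_n] (@rV_cons n).
Proof.
apply: measurable_fun_rVP => i.
have [->|] := eqVneq i ord0.
  under eq_fun do rewrite rV_cons0; exact: measurable_fst.
rewrite eq_sym => /unlift_some[j -> _].
under eq_fun do rewrite rV_cons_lift.
exact: (measurableT_comp (measurable_coord_rV j) measurable_snd).
Qed.

Lemma measurable_rV_uncons n :
  measurable_fun [set: 'rV[R]_n.+1]
    (@rV_uncons n : _ -> measurableTypeR R * 'rV[R]_n).
Proof.
apply: measurable_fun_pair; first exact: measurable_coord_rV.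
apply: measurable_fun_rVP => i.
under eq_fun do rewrite mxE; exact: measurable_coord_rV.
Qed.

Section step.
Variables (n : nat) (mu : {sigma_finite_measure set 'rV[R]_n -> \bar R}).
Local Open Scope ereal_scope.

Definition lebesgue_rV_step : set 'rV[R]_n.+1 -> \bar R :=
  pushforward (@lebesgue_measure R \x mu)
    (@rV_cons n : measurableTypeR R * 'rV[R]_n -> 'rV[R]_n.+1).

Let push : {measure set 'rV[R]_n.+1 -> \bar R} :=
  measure_function_pushforward__canonical__measure_function_Measure
    (@lebesgue_measure R \x mu) (@measurable_rV_cons n).

HB.instance Definition _ := isMeasure.Build _ _ _ lebesgue_rV_step
  (measure0 push) (measure_ge0 push) (@measure_semi_sigma_additive _ _ _ push).

Let lebesgue_rV_step_sigma_finite : sigma_finite setT lebesgue_rV_step.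
Proof.
have /sigma_finiteP[F [TF ndF mF]] := sigma_finiteT (@lebesgue_measure R).
have /sigma_finiteP[G [TG ndG mG]] := sigma_finiteT mu.
exists (fun k => @rV_uncons n @^-1` (F k `*` G k)).
  rewrite -preimage_bigcup (_ : \bigcup_k (F k `*` G k) = setT)//.
  apply/seteqP; split=> // -[a x] _.
  have [i _ Fa] : (\bigcup_i F i) a by rewrite -TF.
  have [j _ Gx] : (\bigcup_i G i) x by rewrite -TG.
  exists (maxn i j) => //; split.
    by move: a Fa; exact/subsetPset/ndF/leq_maxl.
  by move: x Gx; exact/subsetPset/ndG/leq_maxr.
move=> k; have [mFk Fk] := mF k; have [mGk Gk] := mG k; split.
  rewrite -[X in measurable X]setTI; apply: measurable_rV_uncons => //.
  exact: measurableX.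
rewrite /lebesgue_rV_step /pushforward -comp_preimage.
rewrite (_ : _ \o _ = id); last by apply/funext => p /=; rewrite rV_consK.
by rewrite preimage_id product_measure1E// lte_mul_pinfty// ge0_fin_numE.
Qed.

HB.instance Definition _ := Measure_isSigmaFinite.Build _ _ _
  lebesgue_rV_step lebesgue_rV_step_sigma_finite.

End step.

(* The n-fold product of the one-dimensional Lebesgue measure; it is determined
   by its values on measurable rectangles, see [lebesgue_rV_rectangle]. *)
Fixpoint lebesgue_rV n : {sigma_finite_measure set 'rV[R]_n -> \bar R} :=
  match n with
  | 0%N => dirac (0 : 'rV[R]_0)
  | n'.+1 => lebesgue_rV_step (lebesgue_rV n')
  end.

Lemma lebesgue_rV_rectangle n (A : 'I_n -> set R) :
  (forall i, measurable (A i)) ->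
  lebesgue_rV n [set x | forall i, A i (x ord0 i)] =
  (\prod_(i < n) lebesgue_measure (A i))%E.
Proof.
elim: n A => [|n IH] A mA.
  rewrite big_ord0 /= diracE (_ : _ \in _) //; rewrite inE /=; by case.
rewrite big_ord_recl -IH//= /lebesgue_rV_step /pushforward.
rewrite -product_measure1E//=.
- congr (_ _); apply/seteqP; split => -[a x] /=.
    move=> Ax; split; first by have := Ax ord0; rewrite rV_cons0.
    by move=> i; have := Ax (lift ord0 i); rewrite rV_cons_lift.
  move=> [Aa Ax] i; have [->|] := eqVneq i ord0; first by rewrite rV_cons0.
  by rewrite eq_sym => /unlift_some[j -> _]; rewrite rV_cons_lift.
- exact: mA.
- rewrite [X in measurable X](_ : _ = \bigcap_(i in [set: 'I_n])
      [set x : 'rV[R]_n | A (lift ord0 i) (x ord0 i)]); last first.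
    by apply/seteqP; split => x /= Ax i; [move=> _; exact: Ax|exact: Ax].
  apply: fin_bigcap_measurable => // i _.
  by have := measurable_coord_rV i measurableT (mA (lift ord0 i)); rewrite setTI.
Qed.

End lebesgue_rV.

Definition cofactor_mx (R : comNzRingType) n (A : 'M[R]_n) : 'M[R]_n :=
  \matrix_(i, j) cofactor A i j.

(* Symmetry is not part of this definition: it is required separately of
   conductivities, and it is automatic for the Hessian of a C^2 function. *)
Definition positive_definite (R : numDomainType) n (A : 'M[R]_n) : Prop :=
  forall v : 'rV[R]_n, v != 0 -> 0 < (v *m A *m v^T) ord0 ord0.

(* Points and vectors of R^d are row vectors. With this convention the library
   Jacobian ['J U x] is the matrix DU(x) whose (i, j) entry is the i-th partial
   derivative of U_j, and [row i P] below is the i-th edge of a parallelepiped. *)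
Section calculus.
Context {R : realType} {d : nat}.

Definition partial (W : normedModType R) (i : 'I_d) (f : 'rV[R]_d -> W) :
    'rV[R]_d -> W :=
  'D_(delta_mx ord0 i) f.

(* Functions of class C^k on the whole of R^d (k = 0: continuous). *)
Fixpoint class_C (W : normedModType R) (k : nat) (f : 'rV[R]_d -> W) : Prop :=
  match k with
  | 0%N => continuous f
  | k'.+1 =>
      (forall x, differentiable f x) /\ (forall i, class_C k' (partial i f))
  end.

Definition gradient (f : 'rV[R]_d -> R) (x : 'rV[R]_d) : 'rV[R]_d :=
  \row_i partial i f x.

Definition hessian (f : 'rV[R]_d -> R) (x : 'rV[R]_d) : 'M[R]_d :=
  \matrix_(i, j) partial i (partial j f) x.

Definition parallelepiped (y0 : 'rV[R]_d) (P : 'M[R]_d) : set 'rV[R]_d :=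
  [set y0 + t *m P | t in [set t : 'rV[R]_d | forall i, 0 <= t ord0 i <= 1]].

Definition periodic_along (T : Type) (P : 'M[R]_d) (F : 'rV[R]_d -> T) : Prop :=
  forall (i : 'I_d) (x : 'rV[R]_d), F (x + row i P) = F x.

Definition average (Y : set 'rV[R]_d) (F : 'rV[R]_d -> 'M[R]_d) : 'M[R]_d :=
  \matrix_(i, j)
    ((fine (lebesgue_rV d Y))^-1 * (\int[lebesgue_rV d]_(x in Y) F x i j)).

Definition Linfty_loc (f : 'rV[R]_d -> R) : Prop :=
  measurable_fun [set: 'rV[R]_d] f /\
  forall K : set 'rV[R]_d, compact K ->
    exists M : R, {ae lebesgue_rV d, forall x, K x -> `|f x| <= M}.

Definition test_function (psi : 'rV[R]_d -> R) : Prop :=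
  (forall k, class_C k psi) /\ compact (closure [set x | psi x != 0]).

(* Div S = 0 in the sense of distributions: the j-th component of Div S is the
   divergence of the j-th column of S. *)
Definition distributional_Div_eq0 (S : 'rV[R]_d -> 'M[R]_d) : Prop :=
  forall (j : 'I_d) (psi : 'rV[R]_d -> R), test_function psi ->
    (\int[lebesgue_rV d]_x (\sum_(i < d) S x i j * partial i psi x)%:E = 0)%E.

(* [realizable_electric_matrix_field U sigma]: the matrix field DU is realizable
   with the conductivity sigma. *)
Definition realizable_electric_matrix_field
    (U : 'rV[R]_d -> 'rV[R]_d) (sigma : 'rV[R]_d -> 'M[R]_d) : Prop :=
  [/\ forall i j, Linfty_loc (fun x => sigma x i j),
      forall x, (sigma x)^T = sigma x /\ positive_definite (sigma x)
    & distributional_Div_eq0 (fun x => sigma x *m 'J U x)].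

End calculus.

(* Main.v *)
Require Import Defs.
From mathcomp Require Import all_boot all_order all_algebra fingroup perm.
From mathcomp Require Import all_classical all_reals all_analysis.
From mathcomp Require Import measurable_realfun ring lra.

Import Order.TTheory GRing.Theory Num.Theory.
Import numFieldNormedType.Exports.

Local Open Scope classical_set_scope.
Local Open Scope ring_scope.

Set Implicit Arguments.
Unset Strict Implicit.
Unset Printing Implicit Defensive.

(* Put [V := grad phi o U], so that [DV = DU H] with [H] the Hessian of [phi]
   at [U], and let [c] be the determinant of the average of [DU]. Then
   [sigma = c Cof(DV) (DU)^-1 = (c det DU) det H (DU)^-T H^-1 (DU)^-1] is
   continuous, symmetric and positive definite, since [c det DU > 0] and [H] is
   symmetric positive definite.
   As [sigma DU = c Cof(DV)], it remains to see that [Cof(DV)] is divergence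
   free for [V] of class C^1 only. Tested against [psi], the [j]-th component of
   the divergence is (minus) the integral of the determinant of [DV] with its
   [j]-th column replaced by [grad psi]. If the second derivatives of [V] exist and
   are continuous, expand this determinant over permutations and integrate by
   parts: the terms containing second derivatives of [V] cancel in pairs by the
   symmetry of the Hessians. In general, average [V] over segments of length [h]
   in every coordinate direction, which gains one derivative, and let [h] tend
   to 0. *)

(** * Continuity and measurability on spaces of row vectors *)

Section row_vector_topology.
Context {R : realType} {n : nat}.
Implicit Types (x y : 'rV[R]_n) (f : 'rV[R]_n -> R).

Lemma coord_le_norm_rV x i : `|x ord0 i| <= `|x|.
Proof.
rewrite [leRHS]/Num.norm/= mx_normrE.
by rewrite (le_bigmax _ (fun ij => `|x ij.1 ij.2|) (ord0, i)).
Qed.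

Lemma norm_rV_lt x (e : R) : 0 < e -> (forall i, `|x ord0 i| < e) -> `|x| < e.
Proof.
move=> e0 xe; rewrite [ltLHS]/Num.norm/= mx_normrE.
by apply: bigmax_lt => // -[i j] _ /=; rewrite (ord1 i).
Qed.

(** Compact sets and supports are always enclosed in such cubes; the coordinatewise form exhibits
    them as products of intervals, which gives compactness and finite measure. *)
Definition cube (M : R) : set 'rV[R]_n := [set x | forall i, `|x ord0 i| <= M].

Lemma compact_cube M : compact (cube M).
Proof.
rewrite (_ : cube M = [set x | forall i, `[- M, M]%classic (x ord0 i)]).
  by apply: (rV_compact (A := fun=> `[- M, M]%classic)) => i; exact: segment_compact.
by apply/seteqP; split => x /= Mx i; have := Mx i; rewrite in_itv /= ler_norml.
Qed.

Lemma compact_sub_cube (K : set 'rV[R]_n) : compact K ->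
  exists2 M, 0 < M & K `<=` cube M.
Proof.
move=> /compact_bounded[M [_ /(_ (`|M| + 1))]] KM.
exists (`|M| + 1); first by rewrite ltr_pwDr.
move=> x Kx i; apply: le_trans (coord_le_norm_rV x i) _.
by apply: KM => //; rewrite (le_lt_trans (ler_norm _))// ltrDl.
Qed.

Lemma continuous_bounded_cube f M : continuous f ->
  exists2 B, 0 < B & forall x, cube M x -> `|f x| <= B.
Proof.
move=> cf; have cfK : compact (f @` cube M).
  by apply: continuous_compact; [exact: continuous_subspaceT|exact: compact_cube].
have [B [_ /(_ (`|B| + 1)) fB]] := compact_bounded cfK.
exists (`|B| + 1); first by rewrite ltr_pwDr.
move=> x Mx; apply: fB; last by exists x.
by rewrite (le_lt_trans (ler_norm _))// ltrDl.
Qed.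

(** Uniform continuity with only [x] confined to the cube, so that [y] may leave it. *)
Lemma continuous_unif_cube f M (e : R) : continuous f -> 0 < e ->
  exists2 r, 0 < r &
    forall x y, cube M x -> `|x - y| < r -> `|f x - f y| < e.
Proof.
move=> cf e0; have /compact_near_coveringP := @compact_cube M.
(* Compactness in covering form: a property that holds near each point of the cube for all small [r]
   holds on the whole cube for a common [r]. *)
move=> /(_ R (0^'+) (fun r x => forall y, `|x - y| < r -> `|f x - f y| < e)).
case=> [x Mx|r /= r0 fr]; last first.
  exists (r / 2); first exact: divr_gt0.
  move=> x y Mx xy; apply: (fr (r / 2)) => //=; last exact: divr_gt0.
  by rewrite sub0r normrN gtr0_norm ?divr_gt0// ltr_pdivrMr// ltr_pMr// ltr1n.
have /cvgrPdist_lt/(_ _ (divr_gt0 e0 (@ltr0Sn R 1))) := cf x.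
move=> /nbhs_ballP[r /= r0 fr].
exists (ball x (r / 2), [set s | s < r / 2]) => /=.
  split; first exact: nbhsx_ballx (divr_gt0 _ _).
  by apply: nbhs_right_lt; exact: divr_gt0.
move=> -[z s] /= [xz sr] y zy.
have xz' : `|x - z| < r / 2 by move: xz; rewrite -ball_normE.
have fz : `|f x - f z| < e / 2.
  by apply: fr; rewrite -ball_normE /=; lra.
have fy : `|f x - f y| < e / 2.
  apply: fr; rewrite -ball_normE /=; rewrite -(subrKA z) [ltRHS](splitr r).
  by rewrite (le_lt_trans (ler_normD _ _))// ltrD// (lt_trans zy).
rewrite -(subrKA (f x)) (splitr e) (le_lt_trans (ler_normD _ _))// ltrD//.
by rewrite distrC.
Qed.

End row_vector_topology.

Section continuous_big.
Context {R : realType} {T : topologicalType}.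

Lemma continuous_mul (f g : T -> R) : continuous f -> continuous g ->
  continuous (fun x => f x * g x).
Proof. by move=> cf cg x; apply: cvgM; [exact: cf|exact: cg]. Qed.

Lemma continuous_sub (f g : T -> R) : continuous f -> continuous g ->
  continuous (fun x => f x - g x).
Proof. by move=> cf cg x; apply: cvgB; [exact: cf|exact: cg]. Qed.

Lemma continuous_add (f g : T -> R) : continuous f -> continuous g ->
  continuous (fun x => f x + g x).
Proof. by move=> cf cg x; apply: cvgD; [exact: cf|exact: cg]. Qed.

Lemma continuous_bigprod (I : Type) (r : seq I) (Q : pred I) (F : I -> T -> R) :
  (forall i, Q i -> continuous (F i)) ->
  continuous (fun x => \prod_(i <- r | Q i) F i x).
Proof.
move=> cF x; apply: cvg_big => [|i Qi]; last exact: cF.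
exact: mul_continuous.
Qed.

Lemma continuous_bigsum (I : Type) (r : seq I) (Q : pred I) (F : I -> T -> R) :
  (forall i, Q i -> continuous (F i)) ->
  continuous (fun x => \sum_(i <- r | Q i) F i x).
Proof.
move=> cF x; apply: cvg_big => [|i Qi]; last exact: cF.
exact: add_continuous.
Qed.

End continuous_big.

(** The sum of the absolute values is one continuous function that dominates the whole family. *)
Lemma continuous_family_bounded_cube (R : realType) n (I : finType)
    (F : I -> 'rV[R]_n -> R) M : (forall i, continuous (F i)) ->
  exists2 B, 0 < B & forall i x, cube M x -> `|F i x| <= B.
Proof.
move=> cF; have cS : continuous (fun x => \sum_i `|F i x|).
  by apply: continuous_bigsum => i _ x; exact: (cvg_norm (cF i x)).
have [B B0 SB] := continuous_bounded_cube M cS.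
exists B => // i x Mx; apply: le_trans (SB x Mx).
by rewrite [leRHS]ger0_norm ?sumr_ge0// (bigD1 i)//= lerDl sumr_ge0.
Qed.

Lemma cvg_det (R : realType) (T : Type) (F : set_system T) (FF : Filter F) n
    (A : T -> 'M[R]_n) (B : 'M[R]_n) :
  (forall i j, A t i j @[t --> F] --> B i j) -> \det (A t) @[t --> F] --> \det B.
Proof.
move=> AB; apply: cvg_big => [|s _]; first exact: add_continuous.
apply: cvgM; first exact: cvg_cst.
by apply: cvg_big => [|i _]; [exact: mul_continuous|exact: AB].
Qed.

Lemma continuous_det (R : realType) (T : topologicalType) n (A : T -> 'M[R]_n) :
  (forall i j, continuous (fun x => A x i j)) -> continuous (fun x => \det (A x)).
Proof. by move=> cA x; apply: cvg_det => i j; exact: cA. Qed.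

Lemma continuous_cofactor (R : realType) (T : topologicalType) n
    (A : T -> 'M[R]_n) i j :
  (forall k l, continuous (fun x => A x k l)) ->
  continuous (fun x => cofactor (A x) i j).
Proof.
move=> cA; apply: continuous_mul; first exact: cst_continuous.
apply: continuous_det => k l.
by rewrite (_ : (fun y => _) = (fun y => A y (lift i k) (lift j l))) //;
  apply/funext => y; rewrite !mxE.
Qed.

Section row_vector_measure.
Context {R : realType} {n : nat}.

(** Cubes with rational centre and radius are measurable for the sigma-algebra generated by the
    coordinates, and an open set is the countable union of those it contains. *)
Lemma open_measurable_rV (A : set 'rV[R]_n) : open A -> measurable A.
Proof.
move=> oA.
pose B (q : 'rV[rat]_n * rat) : set 'rV[R]_n :=
  [set x | forall i, `]ratr (q.1 ord0 i) - ratr q.2,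
                       ratr (q.1 ord0 i) + ratr q.2[%classic (x ord0 i)].
have mB q : measurable (B q).
  rewrite (_ : B q = \bigcap_(i in [set: 'I_n])
      [set x | `]ratr (q.1 ord0 i) - ratr q.2,
                 ratr (q.1 ord0 i) + ratr q.2[%classic (x ord0 i)]); last first.
    by apply/seteqP; split => x /= Bx i; [move=> _; exact: Bx|exact: Bx].
  apply: fin_bigcap_measurable => // i _.
  rewrite -[X in measurable X]setTI.
  by apply: (measurable_coord_rV i) => //; exact: measurable_itv.
rewrite (_ : A = \bigcup_q (if pselect (B q `<=` A) then B q else set0)).
  apply: countable_bigcupT_measurable => [|q]; first exact: countableP.
  by case: (pselect _) => BA /=; [exact: mB|exact: measurable0].
apply/seteqP; split => x; last by move=> [q _]; case: pselect => // BA /BA.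
move=> Ax; have /nbhs_ballP[e /= e0 eA] := oA _ Ax.
(* A cube of rational radius below [e / 2], whose centre is within that radius of [x] in each
   coordinate, contains [x] and stays within [e] of it. *)
have /rat_in_itvoo[r] : 0 < e / 2 by apply: divr_gt0.
rewrite in_itv /= => /andP[r0 re].
have qP i : {q : rat | `|x ord0 i - ratr q| < ratr r}.
  apply: cid; have /rat_in_itvoo[q] : x ord0 i < x ord0 i + ratr r by rewrite ltrDl.
  rewrite in_itv /= => /andP[xq qx]; exists q.
  by rewrite ltr_norml; lra.
exists (\row_i sval (qP i), r) => //=.
have BA : B (\row_i sval (qP i), r) `<=` A.
  move=> y By; apply: eA; rewrite -ball_normE /=; apply: norm_rV_lt => // i.
  have := By i; rewrite /= !mxE in_itv/= => /andP[].
  have := svalP (qP i); rewrite !ltr_norml => /andP[].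
  lra.
case: pselect => // _ i; rewrite /= !mxE in_itv/=.
have := svalP (qP i); rewrite !ltr_norml => /andP[]; lra.
Qed.

Lemma continuous_measurable_rV (f : 'rV[R]_n -> R) : continuous f ->
  measurable_fun [set: 'rV[R]_n] f.
Proof.
move=> /continuousP cf; apply: (measurability _ (RGenOpens.measurableE R)).
move=> _ [_ [a [b ->] <-]]; rewrite setTI.
by apply: open_measurable_rV; apply: cf; exact: interval_open.
Qed.

End row_vector_measure.

(** * Integral of a partial derivative *)

(** Both difference quotients are the same function of [h], so this chain rule works with a
    derivative along a single direction. It serves for translations, lines and the insertion of a
    coordinate. *)
Lemma is_derive_affine (R : realType) (V V' W : normedModType R) (c : V -> V')
    (F : V' -> W) (x v : V) (v' : V') (l : W) :
  (forall h, c (h *: v + x) = h *: v' + c x) ->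
  is_derive (c x) v' F l -> is_derive x v (F \o c) l.
Proof.
move=> cE [dF <-].
have E : (fun h => h^-1 *: ((((F \o c) \o shift x) (h *: v)) - (F \o c) x)) =
         (fun h => h^-1 *: ((F \o shift (c x)) (h *: v') - F (c x))).
  by apply/funext => h /=; rewrite cE.
by split; rewrite /derivable /derive E.
Qed.

Lemma is_derive_line (R : realType) (V W : normedModType R) (F : V -> W)
    (x v : V) (t : R) (l : W) :
  is_derive (x + t *: v) v F l -> is_derive t 1 (fun s => F (x + s *: v)) l.
Proof.
apply: (@is_derive_affine _ R V W (fun s => x + s *: v) F t 1 v l) => h.
by rewrite [h *: 1]mulr1 scalerDl addrCA.
Qed.

Lemma is_derive1_continuous (R : realType) (f g : R -> R) :
  (forall t : R, is_derive t 1 f (g t)) -> continuous f.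
Proof.
move=> df t; apply: differentiable_continuous.
by apply/derivable1_diffP; have [] := df t.
Qed.

Lemma continuous_rV (R : realType) (T : topologicalType) n (c : T -> 'rV[R]_n) :
  (forall i, continuous (fun t => c t ord0 i)) -> continuous c.
Proof.
move=> cc x; apply/cvgrPdist_lt => e e0; near=> y.
apply: norm_rV_lt => // i; rewrite !mxE.
move: i; near: y; apply: filter_forall => i.
by have /cvgrPdist_lt/(_ _ e0) := cc i x.
Unshelve. all: by end_near. Qed.

Section rV_cons_calculus.
Context {R : realType} {n : nat}.
Implicit Types (a h : R) (y v : 'rV[R]_n).

Lemma rV_cons_coord0 h a y :
  rV_cons (h * 1 + a, y) = h *: delta_mx ord0 ord0 + rV_cons (a, y).
Proof.
apply/rowP => i; rewrite !mxE eqxx /=; have [->|] := eqVneq i ord0.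
  by rewrite unlift_none.
by rewrite eq_sym => /unlift_some[k -> _]; rewrite liftK mulr0 add0r.
Qed.

Lemma rV_cons_coord_lift h a y i :
  rV_cons (a, h *: delta_mx ord0 i + y) =
  h *: delta_mx ord0 (lift ord0 i) + rV_cons (a, y).
Proof.
apply/rowP => k; rewrite !mxE eqxx /=; have [->|] := eqVneq k ord0.
  by rewrite unlift_none mulr0 add0r.
rewrite eq_sym => /unlift_some[l -> _].
by rewrite liftK !mxE eqxx (inj_eq lift_inj).
Qed.

Lemma continuous_rV_cons_l y : continuous (fun a => rV_cons (a, y)).
Proof.
apply: continuous_rV => i; have [->|] := eqVneq i ord0.
  by under eq_fun do rewrite rV_cons0 /=; move=> ?; exact: cvg_id.
rewrite eq_sym => /unlift_some[k -> _].
by under eq_fun do rewrite rV_cons_lift /=; move=> ?; exact: cst_continuous.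
Qed.

Lemma continuous_rV_cons_r a : continuous (fun y => rV_cons (a, y)).
Proof.
apply: continuous_rV => i; have [->|] := eqVneq i ord0.
  by under eq_fun do rewrite rV_cons0 /=; move=> ?; exact: cst_continuous.
rewrite eq_sym => /unlift_some[k -> _].
by under eq_fun do rewrite rV_cons_lift /=; exact: coord_continuous.
Qed.

End rV_cons_calculus.

Section integrable_cube.
Context {R : realType} {n : nat}.

Lemma measurable_cube (M : R) : measurable (cube M : set 'rV[R]_n).
Proof.
rewrite -[cube M]setCK; apply: measurableC; apply: open_measurable_rV.
apply: closed_openC; apply: compact_closed.
  exact: norm_hausdorff.
exact: compact_cube.
Qed.

Lemma lebesgue_cube_lty (M : R) : (lebesgue_rV n (cube M) < +oo)%E.
Proof.
rewrite (_ : cube M = [set x | forall i, `[- M, M]%classic (x ord0 i)]); last first.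
  by apply/seteqP; split => x /= Mx i; have := Mx i; rewrite in_itv /= ler_norml.
rewrite (@lebesgue_rV_rectangle _ _ (fun=> `[- M, M]%classic)) => [|i];
  last exact: measurable_itv.
rewrite ltey_eq; apply/orP; left.
elim/big_ind : _ => [//|x y|i _]; first exact: fin_numM.
by rewrite lebesgue_measure_itv /=; case: ifPn.
Qed.

Lemma integrable_cube_cst (M B : R) :
  (lebesgue_rV n).-integrable setT (fun x => (B * \1_(cube M) x)%:E).
Proof.
under eq_fun do rewrite EFinM.
apply: integrableZl => //; apply/integrableP; split.
  by apply/measurable_EFinP; apply: measurable_indic; exact: measurable_cube.
under eq_integral do rewrite gee0_abs ?lee_fin//.
rewrite integral_indic ?setIT; [exact: lebesgue_cube_lty|by []|exact: measurable_cube].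
Qed.

Lemma integrable_cube (f : 'rV[R]_n -> R) M : continuous f ->
  (forall x, ~ cube M x -> f x = 0) ->
  (lebesgue_rV n).-integrable setT (EFin \o f).
Proof.
move=> cf f0; have [B B0 fB] := continuous_bounded_cube M cf.
apply: le_integrable (integrable_cube_cst M B) => //.
  by apply/measurable_EFinP; exact: continuous_measurable_rV.
move=> x _ /=; rewrite lee_fin; have [Mx|nMx] := pselect (cube M x).
  by rewrite indicE mem_set// mulr1 (ger0_norm (ltW B0)) fB.
by rewrite f0// normr0.
Qed.

End integrable_cube.

(** The fundamental theorem of calculus on an interval at whose endpoints [f] vanishes. *)
Lemma integral_derive_compact_eq0 (R : realType) (f g : R -> R) (M : R) :
  (forall x : R, is_derive x 1 f (g x)) -> continuous g ->
  (forall x, ~ `|x| <= M -> f x = 0) -> (forall x, ~ `|x| <= M -> g x = 0) ->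
  (\int[lebesgue_measure]_x (g x)%:E = 0)%E.
Proof.
move=> dfg cg f0 g0.
(* Whatever the sign of [M], this [b] is positive and exceeds [M]. *)
pose b := `|M| + 1.
have bM : M < b by rewrite /b (le_lt_trans (ler_norm _))// ltrDl.
have b0 : 0 < b by rewrite /b ltr_pwDr.
have cf : continuous f := is_derive1_continuous dfg.
have fb : f b = 0 by apply: f0; rewrite gtr0_norm// => /(lt_le_trans bM); rewrite ltxx.
have fNb : f (- b) = 0.
  by apply: f0; rewrite normrN gtr0_norm// => /(lt_le_trans bM); rewrite ltxx.
rewrite (_ : (fun x => _) = (EFin \o g) \_ `[- b, b]%classic); last first.
  apply/funext => x; rewrite patchE; case: ifPn => // /negP xb.
  rewrite g0 // => xM; apply: xb; rewrite inE /= in_itv /= -ler_norml.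
  by rewrite (le_trans xM)// ltW.
rewrite -integral_mkcond /= (@continuous_FTC2 _ g f).
- by rewrite fb fNb subee.
- by rewrite gtrN.
- exact: continuous_subspaceT.
- split; [by move=> x _; have [] := dfg x| |].
    by apply: cvg_at_right_filter; exact: cf.
  by apply: cvg_at_left_filter; exact: cf.
- by move=> x _; rewrite derive1E; have [_ ->] := dfg x.
Qed.

(** Fubini and induction on the dimension. If [i] is the first coordinate, the inner integral over
    it vanishes by the one-dimensional case; otherwise the first coordinate is frozen and the
    induction hypothesis applies to the others. *)
Lemma integral_partial_eq0 (R : realType) n (i : 'I_n) (f g : 'rV[R]_n -> R)
    (M : R) :
  (forall x, is_derive x (delta_mx ord0 i) f (g x)) -> continuous g ->
  (forall x, ~ cube M x -> f x = 0) -> (forall x, ~ cube M x -> g x = 0) ->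
  (\int[lebesgue_rV n]_x (g x)%:E = 0)%E.
Proof.
elim: n i f g => [[]//|n IH] i f g dfg cg f0 g0.
have ig := integrable_cube cg g0.
have ncube a (y : 'rV[R]_n) : ~ `|a| <= M \/ ~ cube M y -> ~ cube M (rV_cons (a, y)).
  move=> ay Mx; case: ay; apply.
    by have := Mx ord0; rewrite rV_cons0.
  by move=> k; have := Mx (lift ord0 k); rewrite rV_cons_lift.
(* Fubini requires integrability on the product space; it is carried over from [g] through the
   pushforward that defines the measure. *)
have igc : (@lebesgue_measure R \x lebesgue_rV n)%E.-integrable setT
    ((EFin \o g) \o @rV_cons R n).
  have mg := continuous_measurable_rV cg.
  have mgc : measurable_fun setT
      ((EFin \o g) \o (@rV_cons R n : measurableTypeR R * _ -> _)).
    by apply: measurableT_comp; [exact/measurable_EFinP|exact: measurable_rV_cons].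
  apply/integrableP; split => //.
  have /integrableP[_] := ig; apply: le_lt_trans.
  rewrite /= /lebesgue_rV_step ge0_integral_pushforward //=.
  - exact: measurable_rV_cons.
  - by apply/measurable_EFinP; apply: measurableT_comp.
rewrite /= /lebesgue_rV_step integral_pushforward //=.
- rewrite preimage_setT.
  have [i0|] := eqVneq i ord0.
    rewrite -integral21_prod_meas1 //.
    rewrite /fubini_G integral0_eq // => y _.
    apply: (@integral_derive_compact_eq0 _ (fun a => f (rV_cons (a, y)))
             (fun a => g (rV_cons (a, y))) M) => [a||a aM|a aM].
    + apply: (@is_derive_affine _ _ _ _ (fun a => rV_cons (a, y)) f a 1
                (delta_mx ord0 ord0)); first by move=> h; exact: rV_cons_coord0.
      by rewrite -i0.
    + by move=> a; apply: continuous_comp; [exact: continuous_rV_cons_l|exact: cg].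
    + by apply: f0; apply: ncube; left.
    + by apply: g0; apply: ncube; left.
  rewrite eq_sym => /unlift_some[k ik _].
  rewrite -integral12_prod_meas1 //.
  rewrite /fubini_F integral0_eq // => a _.
  apply: (@IH k (fun y => f (rV_cons (a, y))) (fun y => g (rV_cons (a, y))))
    => [y||y yM|y yM].
  + apply: (@is_derive_affine _ _ _ _ (fun y => rV_cons (a, y)) f y
                (delta_mx ord0 k) (delta_mx ord0 (lift ord0 k))).
      by move=> h; exact: rV_cons_coord_lift.
    by rewrite -ik.
  + by move=> y; apply: continuous_comp; [exact: continuous_rV_cons_r|exact: cg].
  + by apply: f0; apply: ncube; right.
  + by apply: g0; apply: ncube; right.
- exact: measurable_rV_cons.
- by apply/measurable_EFinP; exact: continuous_measurable_rV.
Qed.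

(** * Symmetry of mixed derivatives *)

Section mixed_derivatives.
Context {R : realType} {V : normedModType R}.
Implicit Types (f g : V -> R) (x u v : V).

Lemma MVT_line f g v : (forall x, is_derive x v f (g x)) ->
  forall x (t : R), exists2 c : R, `|c| <= `|t| &
    f (x + t *: v) - f x = g (x + c *: v) * t.
Proof.
move=> df x t.
have dl (s : R) : is_derive s 1 (fun s : R => f (x + s *: v)) (g (x + s *: v)).
  exact: is_derive_line.
have cl := is_derive1_continuous dl.
have fx : f x = f (x + 0 *: v) by rewrite scale0r addr0.
have [t0|t0] := leP 0 t.
  have [c] := MVT_segment t0 (fun s _ => dl s) (continuous_subspaceT cl).
  rewrite in_itv /= => /andP[c0 ct] E; exists c; first by rewrite !ger0_norm.
  by rewrite fx E subr0.
have [c] := MVT_segment (ltW t0) (fun s _ => dl s) (continuous_subspaceT cl).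
rewrite in_itv /= => /andP[c0 ct] E; exists c.
  by rewrite !ler0_norm ?lerN2// ltW.
by rewrite fx -opprB E sub0r mulrN opprK.
Qed.

(** The mean value theorem twice: along [u] for the increment of [f] by [h *: v], then along [v] for
    [fu]. *)
Lemma second_difference f fu fuv u v :
  (forall x, is_derive x u f (fu x)) -> (forall x, is_derive x v fu (fuv x)) ->
  forall x (h : R), exists a b : R, [/\ `|a| <= `|h|, `|b| <= `|h| &
    f (x + h *: u + h *: v) - f (x + h *: u) - (f (x + h *: v) - f x) =
    fuv (x + a *: u + b *: v) * h * h].
Proof.
move=> dfu dfuv x h.
have dF y : is_derive y u (fun y => f (y + h *: v) - f y) (fu (y + h *: v) - fu y).
  apply: is_deriveB; apply: (@is_derive_affine _ _ _ _ (fun y => y + h *: v) f y u u).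
  by move=> k; rewrite addrA.
have [a ah Ea] := MVT_line dF x h.
have [b bh Eb] := MVT_line dfuv (x + a *: u) h.
by exists a, b; split => //; rewrite -Eb -Ea.
Qed.

(** Schwarz's theorem. The second difference is symmetric in [u] and [v], so [fuv] and [fvu] agree
    at two points as close to [x] as desired; continuity brings both points to [x]. *)
Lemma mixed_derivatives_eq f fu fv fuv fvu u v :
  (forall x, is_derive x u f (fu x)) -> (forall x, is_derive x v f (fv x)) ->
  (forall x, is_derive x v fu (fuv x)) -> (forall x, is_derive x u fv (fvu x)) ->
  continuous fuv -> continuous fvu -> fuv =1 fvu.
Proof.
move=> dfu dfv dfuv dfvu cuv cvu x; apply/eqP; rewrite -subr_eq0 -normr_le0.
apply/ler_addgt0Pl => e e0; rewrite addr0.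
have e20 : 0 < e / 2 by apply: divr_gt0.
have /cvgrPdist_lt/(_ _ e20)/nbhs_ballP[r /= r0 Hr] := cuv x.
have /cvgrPdist_lt/(_ _ e20)/nbhs_ballP[s /= s0 Hs] := cvu x.
pose m := Num.min r s; have m0 : 0 < m by rewrite lt_min r0.
(* With the next choice [h * D = m / 2], which keeps all intermediate points within [m] of [x]; the
   summand 1 makes [D] positive even if [u = v = 0]. *)
pose D := `|u| + `|v| + 1; have D0 : 0 < D by rewrite /D ltr_wpDl ?addr_ge0.
pose h := m / 2 / D; have h0 : 0 < h by rewrite !divr_gt0.
have near a b : `|a| <= `|h| -> `|b| <= `|h| -> `|a *: u + b *: v| < m.
  rewrite (gtr0_norm h0) => ah bh; apply: le_lt_trans (ler_normD _ _) _.
  rewrite !normrZ; apply: (@le_lt_trans _ _ (h * D));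
    last by rewrite divfK ?gt_eqF//; lra.
  have := ler_wpM2r (normr_ge0 u) ah; have := ler_wpM2r (normr_ge0 v) bh.
  by rewrite /D; lra.
have [a [b [ah bh E1]]] := second_difference dfu dfuv x h.
have [a' [b' [ah' bh' E2]]] := second_difference dfv dfvu x h.
have E : fuv (x + a *: u + b *: v) = fvu (x + a' *: v + b' *: u).
  have hn0 : h != 0 by rewrite gt_eqF.
  apply: (mulIf hn0); apply: (mulIf hn0); rewrite -E1 -E2.
  by rewrite (addrAC x); ring.
have H1 : `|fuv x - fuv (x + a *: u + b *: v)| < e / 2.
  apply: Hr; rewrite -ball_normE /= -addrA opprD addNKr normrN.
  by rewrite (lt_le_trans (near _ _ ah bh))// ge_min lexx.
have H2 : `|fvu x - fvu (x + a' *: v + b' *: u)| < e / 2.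
  apply: Hs; rewrite -ball_normE /= -addrA opprD addNKr normrN addrC.
  by rewrite (lt_le_trans (near _ _ bh' ah'))// ge_min lexx orbT.
rewrite -(subrKA (fuv (x + a *: u + b *: v))) (splitr e) (le_trans (ler_normD _ _))//.
by rewrite lerD ?(ltW H1)// E distrC ltW.
Qed.

End mixed_derivatives.

(** * Steklov averages *)

Section mean.
Context {R : realType} (h : R).
Hypothesis h0 : 0 < h.
Implicit Types g : R -> R.
Local Notation mu := (@lebesgue_measure R).

Definition mean g : R := h^-1 * \int[mu]_(s in `[0, h]) g s.

Lemma continuous_itv_integrable g (a b : R) : continuous g ->
  mu.-integrable `[a, b] (EFin \o g).
Proof.
move=> cg; apply: continuous_compact_integrable; first exact: segment_compact.
exact: continuous_subspaceT.
Qed.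

Lemma mean_cst c : mean (fun=> c) = c.
Proof.
rewrite /mean Rintegral_cst//= lebesgue_measure_itv /=.
case: ifPn => [_|]; last by rewrite lte_fin h0.
by rewrite /= subr0 mulrCA mulVf ?mulr1 ?gt_eqF.
Qed.

Lemma meanB g1 g2 : continuous g1 -> continuous g2 ->
  mean (fun s => g1 s - g2 s) = mean g1 - mean g2.
Proof.
move=> c1 c2; rewrite /mean -mulrBr RintegralB //; exact: continuous_itv_integrable.
Qed.

Lemma meanZ k g : continuous g -> mean (fun s => k * g s) = k * mean g.
Proof.
move=> cg; rewrite /mean RintegralZl //; last exact: continuous_itv_integrable.
by rewrite mulrCA.
Qed.

Lemma mean_close g1 g2 (e : R) : continuous g1 -> continuous g2 ->
  (forall s : R, 0 <= s <= h -> `|g1 s - g2 s| <= e) -> `|mean g1 - mean g2| <= e.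
Proof.
move=> c1 c2 g12; rewrite -meanB// /mean normrM gtr0_norm ?invr_gt0//.
have cB : continuous (fun s => g1 s - g2 s).
  by move=> s; apply: continuousB; [exact: c1|exact: c2].
rewrite -(mean_cst e) /mean ler_wpM2l ?invr_ge0 ?(ltW h0)//.
rewrite (le_trans (le_normr_Rintegral _ _))//; first exact: continuous_itv_integrable.
apply: le_Rintegral => //.
- apply: continuous_itv_integrable => s.
  exact: (cvg_norm (cB s)).
- by apply: continuous_itv_integrable; exact: cst_continuous.
Qed.

Lemma mean_is_derive g G : continuous g ->
  (forall s : R, 0 <= s <= h -> is_derive s 1 G (g s)) ->
  mean g = h^-1 * (G h - G 0).
Proof.
move=> cg dG; rewrite /mean /Rintegral (@continuous_FTC2 _ g G) //.
- exact: continuous_subspaceT.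
- have cG s : 0 <= s <= h -> G t @[t --> s] --> G s.
    move=> sh; apply: differentiable_continuous; apply/derivable1_diffP.
    by have [] := dG s sh.
  split.
  + move=> s; rewrite in_itv /= => /andP[s0 sh].
    by have [] : is_derive s 1 G (g s) by apply: dG; rewrite !ltW.
  + by apply: cvg_at_right_filter; apply: cG; rewrite lexx ltW.
  + by apply: cvg_at_left_filter; apply: cG; rewrite lexx ltW.
- move=> s; rewrite in_itv /= => /andP[s0 sh]; rewrite derive1E.
  by have [_ ->] : is_derive s 1 G (g s) by apply: dG; rewrite !ltW.
Qed.

(** For a primitive [G] of [g], the mean of the shifted function is [h^-1 * (G (t + h) - G t)],
    which is differentiable even when [g] is only continuous. *)
Lemma is_derive_mean_shift g : continuous g ->
  is_derive (0 : R) 1 (fun t => mean (fun s => g (s + t))) (h^-1 * (g h - g 0)).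
Proof.
move=> cg.
(* The base point -1 makes [G] a primitive on both sides of 0. *)
pose G (u : R) : R := \int[mu]_(s in `[-1, u]) g s.
have dG (u : R) : -1 < u -> is_derive u 1 G (g u).
  move=> u1; have uu1 : u < u + 1 by rewrite ltrDl.
  have [dGu <-] := continuous_FTC1_closed uu1
    (continuous_itv_integrable _ _ cg) u1 (cg u).
  by rewrite derive1E; apply: DeriveDef.
have dH : is_derive (0 : R) 1 (fun t => h^-1 * (G (t + h) - G t))
    (h^-1 * (g h - g 0)).
  have d1 : is_derive (0 : R) 1 (fun t => G (t + h)) (g h).
    apply: (@is_derive_affine _ _ _ _ (fun t => t + h) G 0 1 1).
      by move=> k; rewrite addrA.
    by rewrite add0r; apply: dG; rewrite (lt_trans _ h0)// ltrN10.
  have d2 : is_derive (0 : R) 1 G (g 0) by apply: dG; rewrite ltrN10.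
  exact: is_deriveZ.
(* The formula through [G] holds for [t > -1], that is, near 0, which suffices for the derivative at
   0. *)
apply: near_eq_is_derive dH.
near=> t.
have t1 : -1 < t.
  by near: t; apply: lt_nbhsr; exact: ltrN10.
rewrite (_ : mean _ = h^-1 * (G (h + t) - G (0 + t))); first by rewrite add0r (addrC t).
apply: (@mean_is_derive (fun s => g (s + t)) (fun s => G (s + t))) => [s|s /andP[s0 _]].
  apply: continuous_comp; last exact: cg.
  by apply: continuousD; [exact: cvg_id|exact: cst_continuous].
apply: (@is_derive_affine _ _ _ _ (fun s => s + t) G s 1 1).
  by move=> k; rewrite addrA.
by apply: dG; rewrite (lt_le_trans t1)// lerDr.
Unshelve. all: by end_near. Qed.

End mean.

Section steklov.
Context {R : realType} {n : nat}.
Implicit Types (f g : 'rV[R]_n -> R) (x y v : 'rV[R]_n) (h : R) (a : 'I_n).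
Local Notation e_ a := (delta_mx ord0 a : 'rV[R]_n).

(** An average over a segment in one coordinate direction; iterated over all directions it smooths
    as a mollifier would, with one-dimensional integrals only. *)
Definition steklov h a f x : R := mean h (fun s => f (x + s *: e_ a)).

Lemma continuous_line f x v : continuous f -> continuous (fun s : R => f (x + s *: v)).
Proof.
move=> cf s; apply: continuous_comp; last exact: cf.
by apply: continuousD; [exact: cst_continuous|exact: scalel_continuous].
Qed.

Lemma norm_coord a (s : R) : `|s *: e_ a| <= `|s|.
Proof.
apply/ler_addgt0Pl => e e0; apply/ltW; apply: norm_rV_lt => [|i].
  by rewrite ltr_pwDl.
rewrite !mxE eqxx /= normrM ltr_pwDl// ler_piMr//.
by case: eqP; rewrite ?normr1 ?normr0.
Qed.

Lemma cube_coord x a (h s : R) : 0 <= s <= h -> cube (`|x| + h) (x + s *: e_ a).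
Proof.
move=> /andP[s0 sh] i; apply: le_trans (coord_le_norm_rV _ _) _.
apply: le_trans (ler_normD _ _) _; rewrite lerD2l.
by rewrite (le_trans (norm_coord _ _))// ger0_norm.
Qed.

Variable h : R.
Hypothesis h0 : 0 < h.

Lemma steklov_close a f x (c e : R) : continuous f ->
  (forall s, 0 <= s <= h -> `|f (x + s *: e_ a) - c| <= e) ->
  `|steklov h a f x - c| <= e.
Proof.
move=> cf fc; rewrite -{1}(mean_cst h0 c); apply: mean_close => //.
  exact: continuous_line.
exact: cst_continuous.
Qed.

(** The segment starting at [x] lies in a fixed cube, where uniform continuity compares the two
    integrands for all [s] at once. *)
Lemma continuous_steklov a f : continuous f -> continuous (steklov h a f).
Proof.
move=> cf x; apply/(@cvgrPdist_le _ _ _ (nbhs x) (nbhs_filter x)) => e e0.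
have [r r0 fr] := continuous_unif_cube (`|x| + h) cf e0.
have xr : \forall y \near x, `|x - y| < r.
  by apply/nbhs_ballP; exists r => // y; rewrite -ball_normE.
near=> y; apply: mean_close => // [||s sh]; try exact: continuous_line.
apply/ltW/fr; first exact: cube_coord.
rewrite opprD addrACA subrr addr0.
by near: y.
Unshelve. all: by end_near. Qed.

(** The gain of one derivative: moving [x] along [e_ a] merely shifts the integration variable. *)
Lemma is_derive_steklov_self a f x : continuous f ->
  is_derive x (e_ a) (steklov h a f) (h^-1 * (f (x + h *: e_ a) - f x)).
Proof.
move=> cf; have cl := @continuous_line f x (e_ a) cf.
have [] := is_derive_mean_shift h0 cl; rewrite scale0r addr0.
have E : (fun k : R => k^-1 *: (((fun t => mean h (fun s => f (x + (s + t) *: e_ a))) \o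
            shift 0) (k *: 1) - mean h (fun s => f (x + (s + 0) *: e_ a)))) =
         (fun k => k^-1 *: ((steklov h a f \o shift x) (k *: e_ a) - steklov h a f x)).
  apply/funext => k /=; rewrite addr0 [k *: 1]mulr1 /steklov.
  congr (_ *: (mean h _ - mean h _)); apply/funext => s; last by rewrite addr0.
  by rewrite scalerDl [k *: _ + x]addrC -addrA [k *: _ + _]addrC.
by rewrite /derivable /derive E; split.
Qed.

(** Differentiation under the integral sign: by the mean value theorem the difference quotient of
    the integrand is a value of [g] nearby, uniformly close to [g (x + s *: e_ a)]. *)
Lemma is_derive_steklov a f g v : continuous f -> continuous g ->
  (forall x, is_derive x v f (g x)) ->
  forall x, is_derive x v (steklov h a f) (steklov h a g x).
Proof.
move=> cf cg df x.
suff lim : k^-1 *: ((steklov h a f \o shift x) (k *: v) - steklov h a f x)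
    @[k --> 0^'] --> steklov h a g x.
  by split; [apply/cvg_ex; exists (steklov h a g x)|exact/cvg_lim].
apply/cvgrPdist_le => e e0.
have [r r0 gr] := continuous_unif_cube (`|x| + h) cg e0.
near=> k.
have k0 : k != 0 by near: k; exact: nbhs_dnbhs_neq.
have kv : `|k| * `|v| < r.
  have : `|k| < r / (`|v| + 1).
    by near: k; apply: dnbhs0_lt; rewrite divr_gt0// ltr_wpDl.
  rewrite ltr_pdivlMr ?ltr_wpDl//; apply: le_lt_trans.
  by rewrite ler_wpM2l// lerDl.
have scaleE (b c : R) : b *: (c : R^o) = b * c by [].
rewrite /= /steklov scaleE.
have c1 : continuous (fun s : R => f (k *: v + x + s *: e_ a)) by exact: continuous_line.
have c2 : continuous (fun s : R => f (x + s *: e_ a)) by exact: continuous_line.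
have c3 : continuous (fun s : R => g (x + s *: e_ a)) by exact: continuous_line.
have c12 : continuous (fun s : R => f (k *: v + x + s *: e_ a) - f (x + s *: e_ a)).
  by move=> s; apply: continuousB; [exact: c1|exact: c2].
rewrite -meanB// -meanZ//; apply: mean_close => // [s|s sh].
  by apply: continuous_mul; [exact: cst_continuous|exact: c12].
(* The point [c] depends on [s], but it serves only in a pointwise bound and is never integrated. *)
have [c ck E] := MVT_line df (x + s *: e_ a) k.
rewrite (_ : k *: v + x + s *: e_ a = x + s *: e_ a + k *: v); last first.
  by rewrite [k *: v + x]addrC addrAC.
rewrite E mulrCA mulVf// mulr1; apply/ltW/gr; first exact: cube_coord.
rewrite opprD addNKr normrN normrZ (le_lt_trans _ kv)// ler_wpM2r//.
Unshelve. all: by end_near. Qed.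

Definition steklov_seq (l : seq 'I_n) f := foldr (steklov h) f l.

Lemma continuous_steklov_seq l f : continuous f -> continuous (steklov_seq l f).
Proof. by move=> cf; elim: l => //= a l; exact: continuous_steklov. Qed.

Lemma is_derive_steklov_seq l f g v : continuous f -> continuous g ->
  (forall x, is_derive x v f (g x)) ->
  forall x, is_derive x v (steklov_seq l f) (steklov_seq l g x).
Proof.
move=> cf cg df; elim: l => //= a l IH x.
by apply: is_derive_steklov => //; exact: continuous_steklov_seq.
Qed.

(** Each average looks at most [h] away, hence the radius [h *+ size l]. Taking [c = f x] gives
    convergence as [h] tends to 0; taking [c = 0] gives uniform bounds. *)
Lemma steklov_seq_close l f x (c e : R) : continuous f ->
  (forall y, `|y - x| <= h *+ size l -> `|f y - c| <= e) ->
  `|steklov_seq l f x - c| <= e.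
Proof.
move=> cf; elim: l x => [|a l IH] x /= fc.
  by apply: fc; rewrite subrr normr0.
apply: steklov_close; first exact: continuous_steklov_seq.
move=> s /andP[s0 sh]; apply: IH => y yx; apply: fc.
rewrite mulrSr -(subrKA (x + s *: e_ a)) (le_trans (ler_normD _ _))// lerD//.
by rewrite addrC addKr (le_trans (norm_coord _ _))// ger0_norm.
Qed.

(** The average in direction [a] creates the derivative, and the averages applied after it preserve
    it. *)
Lemma steklov_seq_derivable l f a : continuous f -> a \in l ->
  exists2 g, continuous g & forall x, is_derive x (e_ a) (steklov_seq l f) (g x).
Proof.
move=> cf; elim: l => //= b l IH; rewrite inE => /predU1P[->|/IH[g cg dg]].
  have cl := @continuous_steklov_seq l f cf.
  exists (fun x => h^-1 * (steklov_seq l f (x + h *: e_ b) - steklov_seq l f x)).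
    apply: continuous_mul; first exact: cst_continuous.
    apply: continuous_sub; last exact: cl.
    move=> x; apply: (@continuous_comp _ _ _ (fun y => y + h *: e_ b)); last exact: cl.
    by apply: continuousD; [exact: cvg_id|exact: cst_continuous].
  by move=> x; exact: is_derive_steklov_self.
exists (steklov h b g); first exact: continuous_steklov.
by apply: is_derive_steklov => //; exact: continuous_steklov_seq.
Qed.

End steklov.

(** * Cofactors and positive definite matrices *)

Section column_substitution.
Context {R : comNzRingType} {n : nat}.
Implicit Types (A : 'M[R]_n) (b : 'I_n -> R) (j : 'I_n).

Definition subst_col A b j : 'M[R]_n :=
  \matrix_(i, k) if k == j then b i else A i k.

(** Laplace expansion along column [j]. For [A = DV] and [b] the gradient of a test function, the
    right-hand side is the integrand of the weak divergence of column [j] of the cofactor matrix. *)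
Lemma det_subst_col A b j :
  \det (subst_col A b j) = \sum_i cofactor A i j * b i.
Proof.
rewrite (expand_det_col _ j); apply: eq_bigr => i _; rewrite mxE eqxx mulrC.
congr (_ * \det _ * _); apply/matrixP => k l.
by rewrite !mxE eq_sym (negPf (neq_lift j l)).
Qed.

(** The Leibniz formula is taken for the transpose, so that [s] maps columns to rows and [b]
    contributes the single factor [b (s j)]. *)
Lemma det_subst_col_leibniz A b j : \det (subst_col A b j) =
  \sum_(s : 'S_n) (-1) ^+ s * (b (s j) * \prod_(k | k != j) A (s k) k).
Proof.
rewrite -det_tr; apply: eq_bigr => s _; congr (_ * _).
rewrite (bigD1 j) //= !mxE eqxx; congr (_ * _); apply: eq_bigr => k /negPf kj.
by rewrite !mxE kj.
Qed.

End column_substitution.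

(* Precomposing [s] with the transposition of [j] and [k] changes the sign of
   the [k]-th summand. *)
Lemma alternating_sum_eq0 (R : numDomainType) n (j : 'I_n) (A : 'M[R]_n)
    (H : 'I_n -> 'I_n -> 'I_n -> R) :
  (forall a b k, H a b k = H b a k) ->
  \sum_(s : 'S_n) (-1) ^+ s * (\sum_(k | k != j) H (s j) (s k) k *
    \prod_(m | (m != j) && (m != k)) A (s m) m) = 0.
Proof.
move=> Hsym; under eq_bigr do rewrite mulr_sumr.
rewrite exchange_big big1 //= => k kj.
set S := (X in X = 0); suff SN : S = - S.
  have /eqP : S *+ 2 = 0 by rewrite mulr2n {1}SN addNr.
  by rewrite mulrn_eq0 => /eqP.
rewrite {1}/S (reindex_inj (mulgI (tperm j k))) /= -sumrN.
apply: eq_bigr => s _; rewrite odd_permM odd_tperm eq_sym kj signr_addb mulN1r mulNr.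
congr (- (_ * _)); rewrite !permM tpermL tpermR Hsym; congr (_ * _).
apply: eq_bigr => m /andP[mj mk].
by rewrite permM tpermD // eq_sym.
Qed.

Lemma normr_det_le (R : numDomainType) n (A : 'M[R]_n) (B : R) :
  (forall i j, `|A i j| <= B) ->
  `|\det A| <= \sum_(s : 'S_n) \prod_(i < n) B.
Proof.
move=> AB; apply: le_trans (ler_norm_sum _ _ _) _; apply: ler_sum => s _.
rewrite normrM normrX normrN1 expr1n mul1r normr_prod.
by apply: ler_prod => i _; rewrite normr_ge0 AB.
Qed.

(** * Positive definite matrices and the algebraic form of the conductivity *)

Section positive_definite.
Context {R : realFieldType} {n : nat}.
Implicit Types A B H : 'M[R]_n.

Lemma positive_definite_unitmx A : positive_definite A -> A \in unitmx.
Proof.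
move=> pA; rewrite -row_free_unit; apply/row_freeP.
have kA : kermx A = 0.
  apply/row_matrixP => i; rewrite row0; apply/eqP; apply: contraT => /pA.
  by rewrite -row_mul mulmx_ker row0 mul0mx mxE ltxx.
have : row_free A by rewrite -kermx_eq0 kA.
by move=> /row_freeP.
Qed.

(** A path from the identity to [A] inside the positive definite matrices, used to determine the
    sign of [\det A]. *)
Lemma positive_definite_mix A (t : R) : positive_definite A -> 0 <= t <= 1 ->
  positive_definite ((1 - t) *: 1%:M + t *: A).
Proof.
move=> pA /andP[t0 t1] v v0; have vA := pA v v0.
have vv : 0 < (v *m v^T) ord0 ord0.
  rewrite mxE; have [i vi] : exists i, v ord0 i != 0.
    apply/existsP; apply: contraT; rewrite negb_exists => /forallP vi.
    by case/eqP: v0; apply/rowP => i; rewrite mxE; apply/eqP; rewrite -[_ == _]negbK.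
  apply: (@lt_le_trans _ _ (v ord0 i * v^T i ord0)).
    by rewrite mxE -expr2 exprn_even_gt0.
  rewrite (bigD1 i) //= lerDl; apply: sumr_ge0 => k _.
  by rewrite mxE -expr2 sqr_ge0.
rewrite mulmxDr -!scalemxAr mulmx1 mulmxDl -!scalemxAl.
rewrite [in X in _ < X]mxE [X in X + _]mxE [X in _ + X]mxE.
have [->|t_lt1] := eqVneq t 1; first by rewrite subrr mul0r add0r mul1r.
rewrite ltr_wpDr ?mulr_ge0// ?ltW// mulr_gt0//.
by rewrite subr_gt0 lt_neqAle t_lt1.
Qed.

(** The form of [invmx A] at [v] is the form of [A] at [v *m invmx A], by symmetry of [A]. *)
Lemma positive_definite_invmx A : A^T = A -> positive_definite A ->
  positive_definite (invmx A).
Proof.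
move=> sA pA v v0; have uA := positive_definite_unitmx pA.
have := pA (v *m invmx A); rewrite mulmxKV// trmx_mul trmx_inv sA mulmxA; apply.
by apply: contra_neq v0 => vA; rewrite -(mulmxKV uA v) vA mul0mx.
Qed.

Lemma positive_definite_congr A B : B \in unitmx -> positive_definite A ->
  positive_definite (B *m A *m B^T).
Proof.
move=> uB pA v v0; have := pA (v *m B); rewrite trmx_mul !mulmxA; apply.
by apply: contra_neq v0 => vB; rewrite -(mulmxK uB v) vB mul0mx.
Qed.

Lemma positive_definiteZ A (c : R) : 0 < c -> positive_definite A ->
  positive_definite (c *: A).
Proof.
by move=> c0 pA v v0; rewrite -scalemxAr -scalemxAl mxE mulr_gt0 ?pA.
Qed.

End positive_definite.

Lemma invmx_det_adj (R : comUnitRingType) n (A : 'M[R]_n) : A \in unitmx ->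
  \adj A = \det A *: invmx A.
Proof.
move=> uA; rewrite /invmx uA scalerA divrr ?scale1r//.
Qed.

Lemma cofactor_mxE (R : comUnitRingType) n (A : 'M[R]_n) : A \in unitmx ->
  cofactor_mx A = \det A *: (invmx A)^T.
Proof.
move=> uA; rewrite -linearZ -invmx_det_adj //=.
by apply/matrixP => i j; rewrite !mxE.
Qed.

(** Since [H] is symmetric, [Cof(BH) = det(B) det(H) B^-T H^-1]; thus [S] is a positive multiple of
    [B^-T H^-1 B^-1], which is congruent to [H^-1]. *)
Lemma cofactor_conductivity (R : realFieldType) n (c : R) (B H : 'M[R]_n) :
  0 < c * \det B -> 0 < \det H -> H^T = H -> positive_definite H ->
  let S := c *: cofactor_mx (B *m H) *m invmx B in
  S^T = S /\ positive_definite S.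
Proof.
move=> cB dH sH pH S.
have uH := positive_definite_unitmx pH.
have uB : B \in unitmx.
  rewrite unitmxE unitfE; apply: contraTneq cB => ->.
  by rewrite mulr0 ltxx.
have invBH : invmx (B *m H) = invmx H *m invmx B.
  have uBH : B *m H \in unitmx by rewrite unitmx_mul uB.
  by rewrite -[RHS](mulKmx uBH) -!mulmxA (mulKVmx uH) mulmxV// mulmx1.
(* The double transpose gives the shape expected by [positive_definite_congr]. *)
have SE : S = (c * \det B * \det H) *: ((invmx B)^T *m invmx H *m (invmx B)^T^T).
  rewrite /S cofactor_mxE ?unitmx_mul ?uB// det_mulmx trmxK.
  rewrite -!scalemxAl scalerA mulrA invBH trmx_mul [(invmx H)^T]trmx_inv sH.
  by [].
split.
  by rewrite SE linearZ /= !trmx_mul !trmxK [(invmx H)^T]trmx_inv sH mulmxA.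
rewrite SE; apply: positive_definiteZ; first exact: mulr_gt0.
apply: positive_definite_congr; first by rewrite unitmx_tr unitmx_inv.
exact: positive_definite_invmx.
Qed.

(** Along the path from the identity to [A] the determinant starts at 1 and never vanishes, so by
    the intermediate value theorem it ends positive. *)
Lemma positive_definite_det_gt0 (R : realType) n (A : 'M[R]_n) :
  positive_definite A -> 0 < \det A.
Proof.
move=> pA; pose f (t : R) := \det ((1 - t) *: 1%:M + t *: A).
have f0 : f 0 = 1 by rewrite /f subr0 scale1r scale0r addr0 det1.
have f1 : f 1 = \det A by rewrite /f subrr scale1r scale0r add0r.
have fn0 t : 0 <= t <= 1 -> f t != 0.
  move=> t01; rewrite -unitfE -unitmxE.
  exact/positive_definite_unitmx/positive_definite_mix.
have cf : continuous f.
  apply: continuous_det => i j.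
  under eq_fun do rewrite !mxE.
  move=> t; apply: cvgD; apply: cvgM; try exact: cvg_cst; last exact: cvg_id.
  by apply: cvgB; [exact: cvg_cst|exact: cvg_id].
rewrite -f1 ltNge; apply/negP => f1le0.
have [|t] := @IVT R f 0 1 0 ler01 (continuous_subspaceT cf).
  by rewrite f0 ge_min le_max ler01 f1le0 orbT.
by rewrite in_itv /= => /fn0 /eqP.
Qed.

Lemma continuous_invmx (R : realType) (T : topologicalType) n (A : T -> 'M[R]_n) :
  (forall x, A x \in unitmx) -> (forall i k, continuous (fun x => A x i k)) ->
  forall i k, continuous (fun x => invmx (A x) i k).
Proof.
move=> uA cA i k.
rewrite (_ : (fun x => _) = fun x => (\det (A x))^-1 * cofactor (A x) k i).
  apply: continuous_mul; last exact: continuous_cofactor.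
  move=> x; apply: cvgV; last exact: continuous_det.
  by rewrite -unitfE -unitmxE.
by apply/funext => x; rewrite /invmx uA !mxE.
Qed.

Lemma continuous_cofactor_mul_invmx (R : realType) (T : topologicalType) n
    (A B : T -> 'M[R]_n) (c : R) :
  (forall i k, continuous (fun x => A x i k)) ->
  (forall x, B x \in unitmx) -> (forall i k, continuous (fun x => B x i k)) ->
  forall i k, continuous (fun x => (c *: cofactor_mx (A x) *m invmx (B x)) i k).
Proof.
move=> cA uB cB i k; under eq_fun do rewrite mxE.
apply: continuous_bigsum => l _; apply: continuous_mul; last exact: continuous_invmx.
under eq_fun do rewrite !mxE.
by apply: continuous_mul; [exact: cst_continuous|exact: continuous_cofactor].
Qed.

(** * The Piola identity *)

(** The product rule; [uniq r] ensures that the condition [m != i] removes exactly one factor. *)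
Lemma is_derive_bigprod (R : realType) (V : normedModType R) (I : eqType)
    (r : seq I) (Q : pred I) (f : I -> V -> R) (df : I -> R) (x v : V) :
  uniq r -> (forall i, Q i -> is_derive x v (f i) (df i)) ->
  is_derive x v (fun y => \prod_(i <- r | Q i) f i y)
    (\sum_(i <- r | Q i) df i * \prod_(m <- r | Q m && (m != i)) f m x).
Proof.
move=> + dfi; elim: r => [_|a r IH /= /andP[ar ur]].
  under eq_fun do rewrite big_nil; rewrite big_nil; exact: is_derive_cst.
have {IH}dr := IH ur.
have [Qa|nQa] := boolP (Q a); last first.
  under eq_fun do rewrite big_cons (negPf nQa).
  rewrite big_cons (negPf nQa); apply: is_derive_eq dr _.
  by apply: eq_bigr => i Qi; rewrite big_cons (negPf nQa).
under eq_fun do rewrite big_cons Qa.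
apply: is_derive_eq (is_deriveM (dfi a Qa) dr) _.
rewrite big_cons Qa addrC; congr (_ + _).
  rewrite [LHS]mulrC; congr (_ * _).
  rewrite big_cons Qa eqxx /= big_seq_cond [RHS]big_seq_cond.
  apply: eq_bigl => m; have [mr|//] := boolP (m \in r).
  by rewrite (_ : m != a) ?andbT //; apply: contraNneq ar => <-.
rewrite [LHS]mulr_sumr [LHS]big_seq_cond [RHS]big_seq_cond.
apply: eq_bigr => i /andP[ir Qi].
rewrite big_cons Qa (_ : a != i) /=; last by apply: contraNneq ar => ->.
by rewrite mulrCA.
Qed.

Section piola.
Context {R : realType} {n : nat}.
Variables (j : 'I_n) (psi : 'rV[R]_n -> R) (dpsi : 'I_n -> 'rV[R]_n -> R) (M : R).
Local Notation e_ a := (delta_mx ord0 a : 'rV[R]_n).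

Hypothesis psi_derive : forall i x, is_derive x (e_ i) psi (dpsi i x).
Hypothesis psi_cont : continuous psi.
Hypothesis dpsi_cont : forall i, continuous (dpsi i).
Hypothesis psi_out : forall x, ~ cube M x -> psi x = 0.
Hypothesis dpsi_out : forall i x, ~ cube M x -> dpsi i x = 0.

(** [G i k] stands for the first partials of [V k] and [H l i k] for the second ones. For each
    permutation [s], [D s] is the derivative of [psi * P s] in direction [s j], so its integral is
    zero. *)
Lemma piola_smooth (G : 'I_n -> 'I_n -> 'rV[R]_n -> R)
    (H : 'I_n -> 'I_n -> 'I_n -> 'rV[R]_n -> R) :
  (forall i k, continuous (G i k)) -> (forall l i k, continuous (H l i k)) ->
  (forall l i k x, is_derive x (e_ l) (G i k) (H l i k x)) ->
  (forall l i k x, H l i k x = H i l k x) ->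
  (\int[lebesgue_rV n]_x
    (\det (subst_col (\matrix_(i, k) G i k x) (dpsi ^~ x) j))%:E = 0)%E.
Proof.
move=> cG cH dG Hsym.
pose P (s : 'S_n) x := \prod_(k | k != j) G (s k) k x.
pose Q (s : 'S_n) x := \sum_(k | k != j) H (s j) (s k) k x *
   \prod_(m | (m != j) && (m != k)) G (s m) m x.
pose D (s : 'S_n) x := psi x * Q s x + P s x * dpsi (s j) x.
have cP s : continuous (P s) by apply: continuous_bigprod => k _; exact: cG.
have cQ s : continuous (Q s).
  apply: continuous_bigsum => k _; apply: continuous_mul; first exact: cH.
  by apply: continuous_bigprod => m _; exact: cG.
have cD s : continuous (D s).
  apply: continuous_add; first by apply: continuous_mul => //; exact: cQ.
  by apply: continuous_mul; [exact: cP|exact: dpsi_cont].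
have D_out s x : ~ cube M x -> D s x = 0.
  by move=> Mx; rewrite /D psi_out// dpsi_out// mul0r mulr0 addr0.
have dD (s : 'S_n) x : is_derive x (e_ (s j)) (fun x => psi x * P s x) (D s x).
  have dP : is_derive x (e_ (s j)) (P s) (Q s x).
    apply: (@is_derive_bigprod _ _ _ _ _ (fun k => G (s k) k)).
    exact: index_enum_uniq.
  exact: (is_deriveM (psi_derive (s j) x) dP).
(* The signed sum of the [Q s] vanishes pointwise by [alternating_sum_eq0], so adding [psi * Q s] to
   each Leibniz term leaves the integrand unchanged. *)
transitivity (\int[lebesgue_rV n]_x (\sum_(s : 'S_n) ((-1) ^+ s * D s x)%:E))%E.
  apply: eq_integral => x _; rewrite sumEFin det_subst_col_leibniz; congr EFin.
  under [RHS]eq_bigr do rewrite mulrDr mulrCA.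
  rewrite big_split /= -mulr_sumr.
  have Q0 : \sum_(s : 'S_n) (-1) ^+ s * Q s x = 0.
    rewrite -[RHS](alternating_sum_eq0 j (\matrix_(i, k) G i k x)
      (H := fun a b k => H a b k x) (fun a b k => Hsym a b k x)).
    apply: eq_bigr => s _; congr (_ * _); apply: eq_bigr => k _; congr (_ * _).
    by apply: eq_bigr => m _; rewrite mxE.
  rewrite Q0 mulr0 add0r; apply: eq_bigr => s _; rewrite [P s x * _]mulrC.
  by congr (_ * (_ * _)); apply: eq_bigr => k _; rewrite mxE.
have iD (s : 'S_n) : (lebesgue_rV n).-integrable setT (EFin \o D s).
  exact: integrable_cube (cD s) (D_out s).
rewrite integral_sum //= => [|s]; last first.
  under eq_fun do rewrite EFinM; apply: integrableZl => //; exact: iD.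
apply: big1 => s _; under eq_integral do rewrite EFinM.
rewrite integralZl //; last exact: iD.
rewrite (@integral_partial_eq0 _ _ (s j) (fun x => psi x * P s x) (D s) M) ?mule0 //.
  by move=> x Mx; rewrite psi_out// mul0r.
exact: D_out.
Qed.

(* Averaging over small segments in all coordinate directions turns the C^1
   functions [V k] into C^2 functions, to which [piola_smooth] applies. *)
Lemma piola_weak (V : 'I_n -> 'rV[R]_n -> R) (G : 'I_n -> 'I_n -> 'rV[R]_n -> R) :
  (forall k, continuous (V k)) -> (forall i k, continuous (G i k)) ->
  (forall i k x, is_derive x (e_ i) (V k) (G i k x)) ->
  (\int[lebesgue_rV n]_x
    (\det (subst_col (\matrix_(i, k) G i k x) (dpsi ^~ x) j))%:E = 0)%E.
Proof.
move=> cV cG dV.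
pose h (N : nat) : R := N.+1%:R^-1.
have h0 N : 0 < h N by rewrite invr_gt0.
have h1 N : h N <= 1 by rewrite invf_le1// ler1n.
pose S N := steklov_seq (h N) (enum 'I_n).
pose f_ N x := \det (subst_col (\matrix_(i, k) S N (G i k) x) (dpsi ^~ x) j).
pose f x := \det (subst_col (\matrix_(i, k) G i k x) (dpsi ^~ x) j).
have cS N g : continuous g -> continuous (S N g).
  by move=> cg; exact: continuous_steklov_seq.
have csub (A : 'rV[R]_n -> 'M[R]_n) : (forall i k, continuous (fun x => A x i k)) ->
    continuous (fun x => \det (subst_col (A x) (dpsi ^~ x) j)).
  move=> cA; apply: continuous_det => i k.
  under eq_fun do rewrite mxE.
  by case: (k == j); [exact: dpsi_cont|exact: cA].
have f_eq0 N : (\int[lebesgue_rV n]_x (f_ N x)%:E = 0)%E.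
  (* Existence is stated as data, since the second derivatives must form a family of functions
     indexed by [l], [i], [k]. *)
  have dH l i k : {H | continuous H &
      forall x, is_derive x (e_ l) (S N (G i k)) (H x)}.
    have [|H cH dH] := @cid2 _ _ _
      (steklov_seq_derivable (h0 N) (cG i k) (_ : l \in enum 'I_n)).
      by rewrite mem_enum.
    by exists H.
  apply: (@piola_smooth (fun i k => S N (G i k)) (fun l i k => s2val (dH l i k))).
  - by move=> i k; exact: cS.
  - by move=> l i k; exact: (s2valP (dH l i k)).
  - by move=> l i k; exact: (s2valP' (dH l i k)).
  (* The averages of [G i k] and [G l k] are first partials of the same function [S N (V k)]. *)
  - move=> l i k; apply: (@mixed_derivatives_eq _ _ (S N (V k))
      (S N (G i k)) (S N (G l k)) _ _ (e_ i) (e_ l)).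
    + by apply: is_derive_steklov_seq.
    + by apply: is_derive_steklov_seq.
    + exact: (s2valP' (dH l i k)).
    + exact: (s2valP' (dH i l k)).
    + exact: (s2valP (dH l i k)).
    + exact: (s2valP (dH i l k)).
have Scvg g x : continuous g -> S N g x @[N --> \oo] --> g x.
  move=> cg; apply/cvgrPdist_le => e e0.
  have /cvgrPdist_le/(_ _ e0)/nbhs_ballP[r /= r0 gr] := cg x.
  (* The [n] averages reach as far as [h N * n]; dividing by [n.+1] also covers [n = 0]. *)
  have hr : \forall N \near \oo, h N < r / n.+1%:R.
    have rn0 : 0 < r / n.+1%:R by rewrite divr_gt0.
    exact: near_infty_natSinv_lt (PosNum rn0).
  near=> N; rewrite distrC; apply: steklov_seq_close => // y yx.
  rewrite distrC; apply: gr; rewrite -ball_normE /= distrC (le_lt_trans yx)//.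
  rewrite size_enum_ord -mulr_natr.
  apply: (@le_lt_trans _ _ (h N * n.+1%:R)).
    by rewrite ler_wpM2l ?(ltW (h0 N))// ler_nat.
  by rewrite -ltr_pdivlMr//; near: N.
(* At points of [cube M] the averages involve points at distance at most [h N * n <= n], whence the
   larger cube. *)
have [B B0 GB] : exists2 B, 0 < B &
    forall i k x, cube (M + n%:R) x -> `|G i k x| <= B.
  have [B B0 GB] := continuous_family_bounded_cube (M + n%:R)
    (fun ik : 'I_n * 'I_n => cG ik.1 ik.2).
  by exists B => // i k; exact: (GB (i, k)).
have [C C0 psiC] : exists2 C, 0 < C &
    forall i x, cube (M + n%:R) x -> `|dpsi i x| <= C.
  exact: continuous_family_bounded_cube.
pose E := \sum_(s : 'S_n) \prod_(i < n) Num.max B C.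
have SB N i k x : cube M x -> `|S N (G i k) x| <= B.
  move=> Mx; rewrite -[S N _ _]subr0; apply: steklov_seq_close => // y yx.
  rewrite subr0; apply: GB => l; rewrite -(subrK x y) mxE.
  rewrite (le_trans (ler_normD _ _))// addrC lerD//.
  rewrite (le_trans (coord_le_norm_rV _ _))// (le_trans yx)//.
  by rewrite size_enum_ord -[h N *+ n]mulr_natr ler_piMl.
have := @dominated_convergence _ _ _ (lebesgue_rV n) setT measurableT
  (fun N => EFin \o f_ N) (EFin \o f) (fun x => (E * \1_(cube M) x)%:E).
case.
- move=> N; apply/measurable_EFinP; apply: continuous_measurable_rV; apply: csub => i k.
  by under eq_fun do rewrite mxE; exact: cS.
- apply/measurable_EFinP; apply: continuous_measurable_rV; apply: csub => i k.
  by under eq_fun do rewrite mxE; exact: cG.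
- apply: aeW => x _; apply: cvg_EFin; first by near=> N.
  apply: cvg_det => i k; rewrite !mxE.
  under eq_fun do rewrite !mxE.
  by case: (k == j); [exact: cvg_cst|exact: Scvg].
- exact: integrable_cube_cst.
- apply: aeW => x N _ /=; rewrite lee_fin.
  have [Mx|nMx] := pselect (cube M x).
    rewrite indicE mem_set// mulr1; apply: normr_det_le => i k.
    rewrite !mxE le_max; case: ifP => _; last by rewrite SB.
    rewrite psiC ?orbT// => l; by rewrite (le_trans (Mx l))// lerDl.
  (* Outside the cube column [j] is zero, and so is the determinant. *)
  rewrite /f_ det_subst_col big1 ?normr0 => [|i _]; last by rewrite dpsi_out// mulr0.
  by rewrite mulr_ge0// sumr_ge0// => s _; rewrite prodr_ge0// => i _;
    rewrite le_max ltW.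
move=> _ _ lim; apply: (cvg_unique _ lim) => //.
rewrite (_ : (fun N => _) = cst 0%E); last by apply/funext => N; exact: f_eq0.
exact: cvg_cst.
Unshelve. all: by end_near. Qed.

End piola.

(** * Functions of class C^k *)

Section class_C_facts.
Context {R : realType} {d : nat}.
Local Notation e_ a := (delta_mx ord0 a : 'rV[R]_d).

Lemma is_derive_partial (W : normedModType R) (f : 'rV[R]_d -> W) i x :
  differentiable f x -> is_derive x (e_ i) f (partial i f x).
Proof. by move=> df; apply: derivableP; exact: diff_derivable. Qed.

Lemma jacobianE m (f : 'rV[R]_d -> 'rV[R]_m) x i k : differentiable f x ->
  'J f x i k = partial i f x ord0 k.
Proof.
by move=> df; rewrite /partial deriveEjacobian// -rowE [RHS]mxE.
Qed.

Lemma partial_coord m (f : 'rV[R]_d -> 'rV[R]_m) x i k : differentiable f x ->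
  partial i f x ord0 k = partial i (fun y => f y ord0 k) x.
Proof.
move=> df; rewrite /partial derive_mx ?mxE//; exact: diff_derivable.
Qed.

Lemma diff_partial (f : 'rV[R]_d -> R) x (v : 'rV[R]_d) : differentiable f x ->
  'd f x v = \sum_l v ord0 l * partial l f x.
Proof.
move=> df; rewrite {1}(row_sum_delta v) linear_sum; apply: eq_bigr => l _.
by rewrite linearZ /= /partial deriveE.
Qed.

Lemma partial_comp (g : 'rV[R]_d -> R) (U : 'rV[R]_d -> 'rV[R]_d) x i :
  differentiable U x -> differentiable g (U x) ->
  partial i (g \o U) x = \sum_l 'J U x i l * partial l g (U x).
Proof.
move=> dU dg; rewrite /partial deriveE; last exact: differentiable_comp.
rewrite diff_comp//= diff_partial//; apply: eq_bigr => l _.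
by congr (_ * _); rewrite jacobianE// /partial deriveE.
Qed.

Lemma continuous_jacobian m (f : 'rV[R]_d -> 'rV[R]_m) i k : class_C 1 f ->
  continuous (fun x => 'J f x i k).
Proof.
move=> [df cf]; under eq_fun do rewrite jacobianE//.
move=> x; apply: (@continuous_comp _ _ _ (partial i f) (fun y => y ord0 k)).
  exact: cf.
exact: coord_continuous.
Qed.

Lemma hessian_sym (f : 'rV[R]_d -> R) x : class_C 2 f ->
  (hessian f x)^T = hessian f x.
Proof.
move=> [df cf]; apply/matrixP => i k; rewrite !mxE.
apply: (@mixed_derivatives_eq _ _ f (partial i f) (partial k f) _ _ (e_ i) (e_ k)).
- by move=> y; exact: is_derive_partial.
- by move=> y; exact: is_derive_partial.
- by move=> y; apply: is_derive_partial; exact: (cf i).1.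
- by move=> y; apply: is_derive_partial; exact: (cf k).1.
- exact: (cf i).2.
- exact: (cf k).2.
Qed.

Lemma differentiable_gradient (f : 'rV[R]_d -> R) x : class_C 2 f ->
  differentiable (gradient f) x.
Proof.
move=> [_ cf].
rewrite (_ : gradient f = \sum_(k < d) (fun y => partial k f y *: e_ k)).
  apply: differentiable_sum => k; apply: differentiableZl; exact: (cf k).1.
apply/funext => y; rewrite fct_sumE.
by rewrite {1}(row_sum_delta (gradient f y)); apply: eq_bigr => k _; rewrite mxE.
Qed.

(** The chain rule; as row index means direction of differentiation, ['J U x] stands on the left. *)
Lemma jacobian_gradient_comp (f : 'rV[R]_d -> R) (U : 'rV[R]_d -> 'rV[R]_d) x :
  class_C 2 f -> differentiable U x ->
  'J (gradient f \o U) x = 'J U x *m hessian f (U x).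
Proof.
move=> cf dU; have dg := differentiable_gradient (U x) cf.
have dgU : differentiable (gradient f \o U) x by exact: differentiable_comp.
apply/matrixP => i k; rewrite jacobianE// partial_coord//.
rewrite (_ : (fun y => _) = partial k f \o U); last first.
  by apply/funext => y; rewrite /= mxE.
rewrite partial_comp//; last exact: (cf.2 k).1.
by rewrite [RHS]mxE; apply: eq_bigr => l _; rewrite [hessian _ _ _ _]mxE.
Qed.

(** The complement of the closed support is open, so [psi] is zero near each point outside the cube,
    and its partials vanish there too. *)
Lemma test_function_cube (psi : 'rV[R]_d -> R) : test_function psi ->
  exists2 M, forall x, ~ cube M x -> psi x = 0 &
    forall i x, ~ cube M x -> partial i psi x = 0.
Proof.
move=> [_ /compact_sub_cube[M _ KM]].
have psi0 x : ~ cube M x -> \forall y \near x, psi y = 0.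
  move=> Mx; have : open (~` closure [set x | psi x != 0]).
    by apply: closed_openC; exact: closed_closure.
  move=> /(_ x) /(_ (fun h => Mx (KM _ h))); apply: filterS => y /= ny.
  apply/eqP; apply: contrapT => /negP py; apply: ny; exact: subset_closure.
exists M => [x Mx|i x Mx]; first exact: nbhs_singleton (psi0 x Mx).
by rewrite /partial (near_eq_derive _ (psi0 x Mx)) derive_cst.
Qed.

Lemma continuous_Linfty_loc (f : 'rV[R]_d -> R) : continuous f -> Linfty_loc f.
Proof.
move=> cf; split; first exact: continuous_measurable_rV.
move=> K /compact_sub_cube[M _ KM]; have [B _ fB] := continuous_bounded_cube M cf.
by exists B; apply: aeW => x Kx; exact/fB/KM.
Qed.

(** By [det_subst_col] the tested divergence is [c] times the integral in [piola_weak], applied to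
    the coordinates of [V]. *)
Lemma distributional_Div_cofactor (V : 'rV[R]_d -> 'rV[R]_d) (c : R) :
  (forall x, differentiable V x) -> (forall i k, continuous (fun x => 'J V x i k)) ->
  distributional_Div_eq0 (fun x => c *: cofactor_mx ('J V x)).
Proof.
move=> dV cJ j psi tpsi; have [M psi0 dpsi0] := test_function_cube tpsi.
have [dpsi cdpsi] := tpsi.1 1%N.
have cpsi : continuous psi by move=> x; exact: differentiable_continuous.
pose D x := \det (subst_col ('J V x) (fun i => partial i psi x) j).
have cD : continuous D.
  apply: continuous_det => i k; rewrite (_ : (fun x => _) = fun x =>
    if k == j then partial i psi x else 'J V x i k).
    by case: (k == j); [exact: cdpsi|exact: cJ].
  by apply/funext => x; rewrite [LHS]mxE.
have D0 x : ~ cube M x -> D x = 0.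
  by move=> Mx; rewrite /D det_subst_col big1// => i _; rewrite dpsi0// mulr0.
transitivity (\int[lebesgue_rV d]_x (c%:E * (D x)%:E))%E.
  apply: eq_integral => x _; rewrite -EFinM; congr EFin.
  rewrite /D det_subst_col mulr_sumr; apply: eq_bigr => i _.
  by rewrite !mxE -mulrA.
rewrite integralZl//; last exact: integrable_cube cD D0.
rewrite (_ : (\int[_]_(x in _) _)%E = 0%E) ?mule0//.
rewrite -[RHS](@piola_weak _ _ j psi (fun i => partial i psi) M _ _ _ _ _
  (fun k x => V x ord0 k) (fun i k x => 'J V x i k)) //.
- apply: eq_integral => x _; congr (\det (subst_col _ _ _))%:E.
  by apply/matrixP => i k; rewrite [RHS]mxE.
- by move=> i x; exact: is_derive_partial.
- move=> k x; apply: (@continuous_comp _ _ _ V (fun y => y ord0 k)).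
    exact: differentiable_continuous.
  exact: coord_continuous.
- move=> i k x; rewrite jacobianE// partial_coord//; apply: is_derive_partial.
  apply: (@differentiable_comp _ _ _ _ V (fun y => y ord0 k)) => //.
  exact: differentiable_coord.
Qed.

End class_C_facts.

(** * Realizability of [DU]: local boundedness, symmetry with positivity, and zero divergence *)

Theorem proposition3p5 (R : realType) (d : nat) (hd : (2 <= d)%N)
    (y0 : 'rV[R]_d) (P : 'M[R]_d) (hP : P \in unitmx)
    (Y := parallelepiped y0 P)
    (U : 'rV[R]_d -> 'rV[R]_d) (hU : class_C 1 U)
    (DU := fun x : 'rV[R]_d => 'J U x)
    (hper : periodic_along P DU)
    (hdet : \det (average Y DU) != 0)
    (hpos : forall x : 'rV[R]_d, 0 < \det (average Y DU *m DU x))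
    (phi : 'rV[R]_d -> R) (hphi : class_C 2 phi)
    (hconv : convex_function [set: convex_lmodType 'rV[R]_d] phi)
    (hhess : forall x, positive_definite (hessian phi x))
    (J := fun x : 'rV[R]_d => \det (average Y DU) *:
                                cofactor_mx ('J (gradient phi \o U) x)) :
  realizable_electric_matrix_field U (fun x => J x *m invmx (DU x)).
Proof.
have dU x : differentiable U x by exact: hU.1.
have uDU x : DU x \in unitmx.
  have := hpos x; rewrite det_mulmx unitmxE unitfE.
  by apply: contraTneq => ->; rewrite mulr0 ltxx.
have cDU i k : continuous (fun x => DU x i k) by exact: continuous_jacobian.
have dV x : differentiable (gradient phi \o U) x.
  by apply: differentiable_comp => //; exact: differentiable_gradient.
have cDV i k : continuous (fun x => 'J (gradient phi \o U) x i k).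
  (* The entries are sums of products of partials of [U] and second partials of [phi] at [U x], all
     continuous. *)
  under eq_fun do rewrite jacobian_gradient_comp// mxE.
  apply: continuous_bigsum => l _; apply: continuous_mul; first exact: cDU.
  under eq_fun do rewrite mxE.
  move=> x; apply: (@continuous_comp _ _ _ U); last exact: ((hphi.2 k).2 l).
  exact: differentiable_continuous.
split.
- move=> i k; apply: continuous_Linfty_loc.
  exact: (@continuous_cofactor_mul_invmx _ _ _ _ _ _ cDV uDU cDU i k).
- move=> x; rewrite /J jacobian_gradient_comp//.
  apply: cofactor_conductivity; last exact: hhess.
  (* By multiplicativity of the determinant this is [hpos]. *)
  + by rewrite -det_mulmx.
  + exact: positive_definite_det_gt0.
  + exact: hessian_sym.
(* The factor [invmx (DU x)] cancels, and the field to test is a constant times a cofactor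
   matrix. *)
- rewrite (_ : (fun x => _) = J); first exact: distributional_Div_cofactor.
  by apply/funext => x; rewrite mulmxKV.
Qed.
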